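(* Let $H$ be a complex Hilbert space and let $F:B(H)_{++}\to B(H)_{++}$ be a map that is non-expansive with respect to the projective Thompson metric, i.e. $\delta_T([F(A)],[F(B)])\le\delta_T([A],[B])$ for all $A,B\in B(H)_{++}$, and suppose $[F(I)]=[I]$. Then for every $A\in B(H)_{++}$, $$\operatorname{OLC}(F(A))\le\operatorname{OLC}(A)\quad\text{and}\quad\operatorname{OMC}(F(A))\le\operatorname{OMC}(A).$$
   Context: $B(H)$ is the algebra of bounded operators on $H$ with operator norm $\|\cdot\|$; $B(H)_{++}$ is the set of positive invertible operators; $I$ is the identity. The Thompson metric is $d_T(A,B):=\|\log(A^{-1/2}BA^{-1/2})\|$; for rays $[A]=\{\lambda A:\lambda>0\}$, $\delta_T([A],[B]):=\inf_{\lambda>0}d_T(A,\lambda B)$. For invertible $A$: $\kappa(A):=\|A\|\,\|A^{-1}\|$, $\operatorname{OMC}(A):=(\kappa(A)-1)/(\kappa(A)+1)$, $\operatorname{OLC}(A):=\operatorname{arctanh}(\operatorname{OMC}(A))=\tfrac12\ln\kappa(A)$. *)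

(* Defs.v *)
From HB Require Import structures.
From mathcomp Require Import all_boot all_order all_algebra sesquilinear complex.
From mathcomp Require Import all_classical all_reals all_analysis.

Set Implicit Arguments.
Unset Strict Implicit.
Unset Printing Implicit Defensive.

Import Order.TTheory GRing.Theory Num.Theory numFieldNormedType.Exports.

Local Open Scope classical_set_scope.
Local Open Scope ring_scope.
Local Open Scope complex_scope.

Section BoundedOperators.
Variables (R : realType) (H : normedModType R[i]).
Implicit Types A B S : H -> H.

Definition bounded_operators : set (H -> H) :=
  [set A : H -> H | linear A /\ exists M : R, forall x, `|A x| <= M%:C * `|x|].

(* The norm of H takes its (nonnegative real) values in R[i], hence the Re. *)
Definition opnorm A : R :=
  sup [set complex.Re `|A x| | x in [set x | `|x| <= 1]].

Definition is_inverse A B : Prop :=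
  [/\ bounded_operators B, B \o A = id & A \o B = id].

Definition invertible A : Prop := exists B, is_inverse A B.

Definition opinv A : H -> H := xget 0 [set B | is_inverse A B].

Definition spectrum A : set R[i] := [set z | ~ invertible (A - z *: id)].

Definition op_horner (p : {poly R}) A : H -> H :=
  \sum_(i < size p) (p`_i)%:C *: iter i A.

(* f(A) is the norm limit of p_n(A) for real polynomials p_n converging to f
   uniformly on the spectrum of A.  This is the continuous functional calculus
   for self-adjoint A, whose spectrum is real; it is applied below only to
   positive invertible operators. *)
Definition is_fun_calc (f : R -> R) A S : Prop :=
  bounded_operators S /\
  forall e : R, 0 < e -> exists p : {poly R},
    (forall t : R, spectrum A t%:C -> `|p.[t] - f t| <= e) /\
    opnorm (op_horner p A - S) <= e.

Definition fun_calc (f : R -> R) A : H -> H :=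
  xget 0 [set S | is_fun_calc f A S].

Definition oplog A : H -> H := fun_calc (@ln R) A.

Definition op_invsqrt A : H -> H := fun_calc (fun t => t `^ (- 2^-1)) A.

Definition thompson A B : R :=
  opnorm (oplog (op_invsqrt A \o B \o op_invsqrt A)).

Definition ray A : set (H -> H) :=
  [set l%:C *: A | l in [set l : R | 0 < l]].

(* The distance between the rays of A and B, as a function of
   representatives. *)
Definition proj_thompson A B : R :=
  inf [set thompson A (l%:C *: B) | l in [set l : R | 0 < l]].

Definition kappa A : R := opnorm A * opnorm (opinv A).

Definition artanh (x : R) : R := ln ((1 + x) / (1 - x)) / 2.

Definition OMC A : R := (kappa A - 1) / (kappa A + 1).

Definition OLC A : R := artanh (OMC A).

(* On a complex space, 0 <= dot (A x) x for all x (which includes that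
   dot (A x) x is real) forces A to be self-adjoint. *)
Definition pos_invertible (dot : H -> H -> R[i]) : set (H -> H) :=
  [set A | [/\ bounded_operators A, forall x, 0 <= dot (A x) x & invertible A]].

End BoundedOperators.

(* Main.v *)
Require Import Defs.
From mathcomp Require Import all_boot all_order all_algebra sesquilinear complex.
From mathcomp Require Import all_classical all_reals all_analysis.
From mathcomp Require Import ring lra.
Import Order.TTheory GRing.Theory Num.Theory numFieldNormedType.Exports.

Local Open Scope classical_set_scope.
Local Open Scope ring_scope.
Local Open Scope complex_scope.

(** For a positive invertible B and c > 0, the projective distance from the ray of
c I to the ray of B is (ln kappa(B))/2 = OLC(B): the spectrum of B lies in
[1/|B^-1|, |B|] and contains both endpoints, so that
d_T(c I, l B) = max(|ln(l/c) + ln|B||, |ln|B^-1| - ln(l/c)|), and this is smallest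
when its two terms agree.  Non-expansiveness between the rays of I and A is
therefore the OLC inequality, and OMC is increasing in OLC.

What has to be known about the functional calculus of the logarithm is its
existence, for which the power series of ln is summed at B, and
|q(B)| <= sup |q| over the real spectrum of B for a real polynomial q.  For the
latter let r = |q(B)|; then r^2 - q(B)^2 is not bounded below, so some factor
B - z of its factorization over the complex numbers is not bounded below; this z
is real, lies in the spectrum of B and satisfies |q(z)| = r.

In the zero space all maps coincide. *)

Set Implicit Arguments.
Unset Strict Implicit.

(** * Real-valued norms and bounded operators *)

Section RealNorm.
Context {R : realType} {H : normedModType R[i]}.
Implicit Types (x y : H) (z : R[i]) (A B T : H -> H).

(** The order of [R[i]] is only partial. Real parts move every estimate into the ordered field R,
    with no loss by [hnormE]. *)
Definition hnorm x : R := complex.Re `|x|.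
Definition cmod z : R := complex.Re `|z|.

Lemma hnormE x : `|x| = (hnorm x)%:C.
Proof.
rewrite /hnorm; have := normr_ge0 x; case: (`|x|) => a b.
by rewrite lecE /= => /andP[/eqP -> _].
Qed.

Lemma cmodE z : `|z| = (cmod z)%:C.
Proof. by rewrite /cmod normc_def. Qed.

Lemma hnorm_ge0 x : 0 <= hnorm x.
Proof. by have := normr_ge0 x; rewrite hnormE (lecR 0). Qed.

Lemma cmod_ge0 z : 0 <= cmod z.
Proof. by have := normr_ge0 z; rewrite cmodE (lecR 0). Qed.

Lemma cmod_real (t : R) : cmod t%:C = `|t|.
Proof. by rewrite /cmod normc_def /= expr0n addr0 sqrtr_sqr. Qed.

Lemma cmod_gt0 z : z != 0 -> 0 < cmod z.
Proof. by rewrite -normr_gt0 cmodE ltcR. Qed.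

Lemma hnormD x y : hnorm (x + y) <= hnorm x + hnorm y.
Proof. by have := ler_normD x y; rewrite !hnormE -rmorphD lecR. Qed.

Lemma hnormZ z x : hnorm (z *: x) = cmod z * hnorm x.
Proof.
have := normrZ z x; rewrite !hnormE cmodE -rmorphM /=.
by move=> [].
Qed.

Lemma hnormZr (t : R) x : hnorm (t%:C *: x) = `|t| * hnorm x.
Proof. by rewrite hnormZ cmod_real. Qed.

Lemma hnormN x : hnorm (- x) = hnorm x.
Proof. by rewrite /hnorm normrN. Qed.

Lemma hnormBC x y : hnorm (x - y) = hnorm (y - x).
Proof. by rewrite /hnorm distrC. Qed.

Lemma hnormB x y : hnorm (x - y) <= hnorm x + hnorm y.
Proof. by rewrite -(hnormN y) hnormD. Qed.

Lemma hnormBB x y : hnorm x - hnorm y <= hnorm (x - y).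
Proof. by rewrite lerBlDr; have := hnormD (x - y) y; rewrite subrK. Qed.

Lemma hnorm0 : hnorm 0 = 0.
Proof. by rewrite /hnorm normr0. Qed.

Lemma hnorm_eq0 x : hnorm x = 0 -> x = 0.
Proof. by move=> x0; apply/eqP; rewrite -normr_eq0 hnormE x0. Qed.

Lemma hnorm_gt0 x : x != 0 -> 0 < hnorm x.
Proof.
by move=> x0; rewrite lt_neqAle hnorm_ge0 andbT eq_sym; apply: contra_neq x0 => /hnorm_eq0.
Qed.

Lemma hnorm_le0 x : hnorm x <= 0 -> x = 0.
Proof. by move=> x0; apply/hnorm_eq0/le_anti; rewrite x0 hnorm_ge0. Qed.

Section LinearMaps.
Context {A : H -> H}.
Hypothesis linA : linear A.

Lemma linD x y : A (x + y) = A x + A y.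
Proof. by have := linA 1 x y; rewrite !scale1r. Qed.

Lemma lin0 : A 0 = 0.
Proof. by have := linD 0 0; rewrite addr0 => /(congr1 (fun u => u - A 0)); rewrite addrK subrr. Qed.

Lemma linZ z x : A (z *: x) = z *: A x.
Proof. by have := linA z x 0; rewrite lin0 !addr0. Qed.

Lemma linN x : A (- x) = - A x.
Proof. by rewrite -scaleN1r linZ scaleN1r. Qed.

Lemma linB x y : A (x - y) = A x - A y.
Proof. by rewrite linD linN. Qed.

Lemma lin_sum n (f : 'I_n -> H) : A (\sum_(i < n) f i) = \sum_(i < n) A (f i).
Proof. by apply: (big_morph A linD lin0). Qed.

End LinearMaps.

Lemma bounded_lin A : bounded_operators A -> linear A.
Proof. by case. Qed.

(** The constant is taken strictly positive so that lower bounds can be formed by dividing by it. *)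
Lemma boundedP A : bounded_operators A <->
  linear A /\ exists2 M : R, 0 < M & forall x, hnorm (A x) <= M * hnorm x.
Proof.
split=> -[linA [M]] => [hM|M0 hM]; split=> //; last first.
  by exists M => x; rewrite !hnormE -rmorphM lecR.
exists (Num.max M 1) => [|x]; first by rewrite lt_max ltr01 orbT.
have := hM x; rewrite !hnormE -rmorphM lecR => /le_trans; apply.
by rewrite ler_wpM2r ?hnorm_ge0// le_max lexx.
Qed.

Lemma bounded_comp A B :
  bounded_operators A -> bounded_operators B -> bounded_operators (A \o B).
Proof.
move=> /boundedP[lA [M M0 hA]] /boundedP[lB [N N0 hB]].
apply/boundedP; split=> [a u v|]; first by rewrite /= lB lA.
exists (M * N) => [|x /=]; first exact: mulr_gt0.
by apply: (le_trans (hA _)); rewrite -mulrA ler_pM2l.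
Qed.

Lemma bounded_add A B :
  bounded_operators A -> bounded_operators B -> bounded_operators (A + B).
Proof.
move=> /boundedP[lA [M M0 hA]] /boundedP[lB [N N0 hB]].
apply/boundedP; split=> [a u v|].
  by rewrite /= !fctE lA lB scalerDr addrACA.
exists (M + N) => [|x /=]; first exact: addr_gt0.
by rewrite !fctE mulrDl (le_trans (hnormD _ _))// lerD.
Qed.

Lemma bounded_scale z A : bounded_operators A -> bounded_operators (z *: A).
Proof.
move=> /boundedP[lA [M M0 hA]].
apply/boundedP; split=> [a u v|].
  by rewrite /= !fctE lA scalerDr !scalerA mulrC.
exists ((cmod z + 1) * M) => [|x /=].
  by rewrite mulr_gt0// ltr_wpDl// cmod_ge0.
rewrite !fctE hnormZ -mulrA ler_pM ?cmod_ge0 ?hnorm_ge0//.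
by rewrite lerDl ler01.
Qed.

Lemma bounded_sub A B :
  bounded_operators A -> bounded_operators B -> bounded_operators (A - B).
Proof.
move=> hA hB; rewrite -scaleN1r; apply: bounded_add => //; exact: bounded_scale.
Qed.

Lemma bounded_id : bounded_operators (@id H).
Proof.
apply/boundedP; split=> [a u v //|]; exists 1 => [|x]; first exact: ltr01.
by rewrite mul1r.
Qed.

Lemma opnorm_has_sup A : bounded_operators A ->
  has_sup [set complex.Re `|A x| | x in [set x | `|x| <= 1]].
Proof.
move=> /boundedP[lA [M M0 hA]]; split.
  by exists (hnorm (A 0)); exists 0 => //=; rewrite normr0 ler01.
exists M => _ [x /= x1 <-]; apply: (le_trans (hA x)).
by rewrite -{2}[M]mulr1 ler_pM2l//; move: x1; rewrite hnormE (lecR _ 1).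
Qed.

Lemma opnorm_ge0 A : bounded_operators A -> 0 <= opnorm A.
Proof.
move=> hA; apply: (le_trans (hnorm_ge0 (A 0))).
apply: ub_le_sup; first by case: (opnorm_has_sup hA).
by exists 0 => //=; rewrite normr0 ler01.
Qed.

Lemma le_opnorm A x : bounded_operators A -> hnorm (A x) <= opnorm A * hnorm x.
Proof.
move=> hA; have linA := bounded_lin hA.
have [->|x0] := eqVneq x 0; first by rewrite (lin0 linA) hnorm0 mulr0.
rewrite -ler_pdivrMr ?hnorm_gt0//.
have e0 : 0 <= (hnorm x)^-1 by rewrite invr_ge0 hnorm_ge0.
apply: ub_le_sup; first by case: (opnorm_has_sup hA).
exists (((hnorm x)^-1)%:C *: x) => /=.
  by rewrite hnormE hnormZr (lecR _ 1) ger0_norm// mulVf// gt_eqF// hnorm_gt0.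
by rewrite (linZ linA) -/(hnorm _) hnormZr ger0_norm// mulrC.
Qed.

Lemma opnorm_le A (K : R) : bounded_operators A -> 0 <= K ->
  (forall x, hnorm (A x) <= K * hnorm x) -> opnorm A <= K.
Proof.
move=> hA K0 hK; apply: ge_sup; first by case: (opnorm_has_sup hA).
move=> _ [x /= x1 <-]; apply: (le_trans (hK x)).
by rewrite -{2}[K]mulr1 ler_wpM2l//; move: x1; rewrite hnormE (lecR _ 1).
Qed.

(* [A - z *: id] fails to be bounded below iff z is an approximate eigenvalue of A. *)
Definition bounded_below T :=
  exists2 d : R, 0 < d & forall x, d * hnorm x <= hnorm (T x).

Lemma is_inverse_inj A B C : is_inverse A B -> is_inverse A C -> B = C.
Proof.
move=> [_ BA _] [_ _ AC].
apply/funext => x; rewrite -[in LHS](congr1 (@^~ x) AC : A (C x) = x).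
exact: (congr1 (@^~ (C x)) BA).
Qed.

Lemma opinvP A : invertible A -> is_inverse A (opinv A).
Proof. exact: xgetPex. Qed.

Lemma opinvE A B : is_inverse A B -> opinv A = B.
Proof. by move=> h; apply: (is_inverse_inj _ h); apply: opinvP; exists B. Qed.

Lemma invertible_bounded_below A : invertible A -> bounded_below A.
Proof.
move=> [B [/boundedP[lB [M M0 hM]] BA _]]; exists M^-1; first by rewrite invr_gt0.
move=> x; rewrite ler_pdivrMl//; have := hM (A x).
by rewrite -[B (A x)]/((B \o A) x) BA.
Qed.

Lemma opnorm_scale (t : R) A : bounded_operators A ->
  opnorm (t%:C *: A) = `|t| * opnorm A.
Proof.
(* Applied to t and A this is one inequality; applied to t^-1 and t A it is the reverse one. *)
suff scale_le s B : bounded_operators B -> opnorm (s%:C *: B) <= `|s| * opnorm B.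
  move=> hA; apply/le_anti/andP; split; first exact: scale_le.
  have [->|t0] := eqVneq t 0; first by rewrite normr0 mul0r opnorm_ge0//; exact: bounded_scale.
  have := scale_le t^-1 _ (bounded_scale t%:C hA).
  rewrite scalerA -rmorphM mulVf// scale1r normfV.
  by rewrite ler_pdivlMl ?normr_gt0.
move=> hB; apply: opnorm_le; first exact: bounded_scale.
  by rewrite mulr_ge0// opnorm_ge0.
by move=> x; rewrite fctE hnormZr -mulrA ler_wpM2l// le_opnorm.
Qed.

End RealNorm.

(** * The real inner product and self-adjoint operators *)

Section RealInner.
Context {R : realType} {H : normedModType R[i]} (dot : {dot H for Num.conj}).
Hypothesis normE : forall x : H, `|x| ^+ 2 = dot x x.
Implicit Types (x y : H) (z : R[i]) (A B T : H -> H).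

Definition rdot x y : R := complex.Re (dot x y).

Lemma dot_herm x y : dot y x = conjc (dot x y).
Proof. by rewrite (hermC dot) expr0 mul1r. Qed.

Lemma rdotC x y : rdot x y = rdot y x.
Proof. by rewrite /rdot [dot y x]dot_herm; case: (dot x y). Qed.

Lemma dotZl z x y : dot (z *: x) y = z * dot x y.
Proof. exact: linearZl_LR. Qed.

Lemma dotDl x y u : dot (x + y) u = dot x u + dot y u.
Proof. exact: linearDl. Qed.

Lemma dotDr x y u : dot u (x + y) = dot u x + dot u y.
Proof. exact: linearDr. Qed.

Lemma dotZr z x y : dot x (z *: y) = conjc z * dot x y.
Proof.
rewrite dot_herm dotZl [dot y x]dot_herm.
by case: (dot x y) z => a b [c d] /=; congr Complex; ring.
Qed.

Lemma rdotDl x y u : rdot (x + y) u = rdot x u + rdot y u.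
Proof. by rewrite /rdot dotDl raddfD. Qed.

Lemma rdotDr x y u : rdot u (x + y) = rdot u x + rdot u y.
Proof. by rewrite rdotC rdotDl !(rdotC u). Qed.

Lemma rdotZl (t : R) x y : rdot (t%:C *: x) y = t * rdot x y.
Proof. by rewrite /rdot dotZl; case: (dot x y) => a b /=; ring. Qed.

Lemma rdotZr (t : R) x y : rdot x (t%:C *: y) = t * rdot x y.
Proof. by rewrite rdotC rdotZl rdotC. Qed.

Lemma rdotNl x y : rdot (- x) y = - rdot x y.
Proof. by rewrite -scaleN1r -[-1](rmorphN1 (real_complex R)) rdotZl mulN1r. Qed.

Lemma rdotBl x y u : rdot (x - y) u = rdot x u - rdot y u.
Proof. by rewrite rdotDl rdotNl. Qed.

Lemma rdotBr x y u : rdot u (x - y) = rdot u x - rdot u y.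
Proof. by rewrite rdotC rdotBl !(rdotC u). Qed.

(** Multiplication by i is skew for the real inner product, which makes the cross terms vanish in
    [selfadj_spectrum_real]. *)
Lemma rdoti x y : rdot x ('i%C *: y) = - rdot ('i%C *: x) y.
Proof.
rewrite rdotC /rdot !dotZl [dot y x]dot_herm.
by case: (dot x y) => a b /=; ring.
Qed.

Lemma rdotxx x : rdot x x = hnorm x ^+ 2.
Proof. by rewrite /rdot -normE hnormE -rmorphXn. Qed.

Lemma hnormB_sqr x y : hnorm (x - y) ^+ 2 = hnorm x ^+ 2 - 2 * rdot x y + hnorm y ^+ 2.
Proof.
rewrite -!rdotxx !(rdotBl, rdotBr) (rdotC y x); ring.
Qed.

(** Cauchy-Schwarz, by expanding the squared norm of |y| x - |x| y. *)
Lemma rdot_le x y : rdot x y <= hnorm x * hnorm y.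
Proof.
have [->|x0] := eqVneq x 0.
  by rewrite hnorm0 mul0r -[0 in X in X <= _](subrr (0 : H)) rdotBl subrr.
have [->|y0] := eqVneq y 0.
  by rewrite hnorm0 mulr0 -[0 in X in X <= _](subrr (0 : H)) rdotBr subrr.
have := sqr_ge0 (hnorm ((hnorm y)%:C *: x - (hnorm x)%:C *: y)).
rewrite hnormB_sqr !hnormZr rdotZl rdotZr !(ger0_norm (hnorm_ge0 _)).
have xy0 : 0 < hnorm x * hnorm y by rewrite mulr_gt0 ?hnorm_gt0.
by move=> h; rewrite -(ler_pM2l xy0); lra.
Qed.

(** For complex linear T this is Hermitian symmetry: replacing x by i x recovers the imaginary
    parts. *)
Definition selfadj T := forall x y, rdot (T x) y = rdot x (T y).

(* Over the complex numbers a form with real diagonal is Hermitian. *)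
Lemma positive_selfadj A : linear A -> (forall x, 0 <= dot (A x) x) -> selfadj A.
Proof.
move=> linA posA x y.
have real_diag u : complex.Im (dot (A u) u) = 0.
  by have := posA u; rewrite lecE => /andP[/eqP].
(* Since the diagonal terms are real, the imaginary part at i x + y is Re (dot (A x) y) - Re (dot (A
   y) x). *)
have := real_diag ('i%C *: x + y); have /eqP := real_diag x; have /eqP := real_diag y.
rewrite (linD linA) (linZ linA) !dotDl !dotDr !dotZl !dotZr.
rewrite /rdot [dot x (A y)]dot_herm.
case: (dot (A x) x) => a a'; case: (dot (A x) y) => b b'.
case: (dot (A y) x) => c c'; case: (dot (A y) y) => d d' /=.
move=> /eqP -> /eqP ->; lra.
Qed.

Lemma positive_rdot_ge0 A : (forall x, 0 <= dot (A x) x) -> forall x, 0 <= rdot (A x) x.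
Proof. by move=> + x => /(_ x); rewrite lecE => /andP[]. Qed.

(** With u = N x - T x, the number <T u, u> >= 0 equals N^2 <T x, x> - 2 N |T x|^2 + <T T x, T x>,
    whose last term is at most N |T x|^2. In operator form, T^2 <= N T. *)
Lemma hnorm_selfadj_le T (N : R) : selfadj T -> linear T -> 0 < N ->
    (forall x, 0 <= rdot (T x) x) -> (forall x, rdot (T x) x <= N * hnorm x ^+ 2) ->
  forall x, hnorm (T x) ^+ 2 <= N * rdot (T x) x.
Proof.
move=> saT linT N0 T0 TN x.
(* positivity of T at N x - T x *)
have := T0 (N%:C *: x - T x).
rewrite (linB linT) (linZ linT) !(rdotBl, rdotBr) !(rdotZl, rdotZr).
rewrite [rdot (T (T x)) x]saT !rdotxx.
by have := TN (T x) => h1 h2; rewrite -(ler_pM2l N0); lra.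
Qed.

(** Gives the contradiction N < N in the two lemmas on attained norms. For e > N^2 the square root
    is 0, still below N. *)
Lemma sqrtr_subr_lt (N e : R) : 0 < N -> 0 < e -> Num.sqrt (N ^+ 2 - e) < N.
Proof.
move=> N0 e0; rewrite -[X in _ < X]gtr0_norm// -sqrtr_sqr ltr_sqrt ?exprn_gt0//.
by rewrite ltrBlDr ltrDl.
Qed.

Lemma opnorm_le_sqrt T (c : R) : bounded_operators T ->
  (forall x, hnorm (T x) ^+ 2 <= c * hnorm x ^+ 2) -> opnorm T <= Num.sqrt c.
Proof.
move=> hT hc; apply: opnorm_le => // x.
rewrite -[hnorm (T x)]ger0_norm ?hnorm_ge0// -sqrtr_sqr.
rewrite -[X in _ <= _ * X]ger0_norm ?hnorm_ge0// -[`|hnorm x|]sqrtr_sqr mulrC.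
by rewrite -sqrtrM ?sqr_ge0// ler_wsqrtr// mulrC.
Qed.

(** If d |x| <= |T x - N x|, expanding the square and using |T x|^2 <= N <T x, x> gives |T x|^2 <=
    (N^2 - d^2) |x|^2, so N would not be the norm. *)
Lemma opnorm_attained T : selfadj T -> bounded_operators T -> 0 < opnorm T ->
    (forall x, hnorm (T x) ^+ 2 <= opnorm T * rdot (T x) x) ->
  ~ bounded_below (T - (opnorm T)%:C *: id).
Proof.
set N := opnorm T => saT hT N0 hN [d d0 hd].
suff : N <= Num.sqrt (N ^+ 2 - d ^+ 2).
  by apply/negP; rewrite -ltNge sqrtr_subr_lt ?exprn_gt0.
apply: opnorm_le_sqrt => // x.
have : (d * hnorm x) ^+ 2 <= hnorm (T x - N%:C *: x) ^+ 2.
  by rewrite lerXn2r ?nnegrE ?hnorm_ge0 ?mulr_ge0 ?hnorm_ge0 ?(ltW d0)//; exact: hd.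
rewrite hnormB_sqr hnormZr rdotZr (gtr0_norm N0) !exprMn; have := hN x; lra.
Qed.

(** For T of indefinite sign the norm may be attained at N or at -N, hence the passage to T^2.
    Expanding |T^2 x - N^2 x|^2 with |T^2 x| <= N |T x| gives |T x|^2 <= (N^2 - (d / N)^2) |x|^2. *)
Lemma opnorm_sqr_attained T : selfadj T -> bounded_operators T -> 0 < opnorm T ->
  ~ bounded_below (T \o T - (opnorm T ^+ 2)%:C *: id).
Proof.
set N := opnorm T => saT hT N0 [d d0 hd].
suff : N <= Num.sqrt (N ^+ 2 - (d / N) ^+ 2).
  by apply/negP; rewrite -ltNge sqrtr_subr_lt ?exprn_gt0 ?divr_gt0.
apply: opnorm_le_sqrt => // x.
have : (d * hnorm x) ^+ 2 <= hnorm (T (T x) - (N ^+ 2)%:C *: x) ^+ 2.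
  by rewrite lerXn2r ?nnegrE ?hnorm_ge0 ?mulr_ge0 ?hnorm_ge0 ?(ltW d0)//; exact: hd.
have : hnorm (T (T x)) ^+ 2 <= (N * hnorm (T x)) ^+ 2.
  by rewrite lerXn2r ?nnegrE ?hnorm_ge0 ?mulr_ge0 ?hnorm_ge0 ?(ltW N0)//; exact: le_opnorm.
rewrite hnormB_sqr hnormZr rdotZr saT rdotxx (gtr0_norm (exprn_gt0 2 N0)) !exprMn => h1 h2.
rewrite -(ler_pM2l (exprn_gt0 2 N0)).
have dE : d = d / N * N by rewrite divfK// gt_eqF.
move: h2; rewrite {1}dE exprMn; lra.
Qed.

(** For z = a + i b the cross term vanishes and |(A - z) x|^2 = |(A - a) x|^2 + b^2 |x|^2, so b
    itself is a lower bound up to sign. *)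
Lemma selfadj_spectrum_real A z : selfadj A -> linear A ->
  ~ bounded_below (A - z *: id) -> complex.Im z = 0.
Proof.
move=> saA linA nbb; apply/eqP/negPn/negP => z0; apply: nbb.
exists `|complex.Im z| => [|x]; first by rewrite normr_gt0.
rewrite -[leLHS]ger0_norm ?mulr_ge0 ?hnorm_ge0// -[leRHS]ger0_norm ?hnorm_ge0//.
rewrite -ler_sqr ?nnegrE// !real_normK ?num_real//.
set a := complex.Re z; set b := complex.Im z.
have rdotix u : rdot u ('i%C *: u) = 0 by have := rdoti u u; rewrite rdotC; lra.
have rdotAix u : rdot (A u) ('i%C *: u) = 0.
  have : rdot (A u) ('i%C *: u) = - rdot ('i%C *: u) (A u) by rewrite saA (linZ linA) rdoti.
  by rewrite (rdotC _ (A u)); lra.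
have -> : (A - z *: id) x = (A x - a%:C *: x) - b%:C *: ('i%C *: x).
  rewrite -addrA -opprD scalerA -scalerDl; congr (A x - _).
  by rewrite [z in LHS]complexE [_ * 'i%C]mulrC.
rewrite [X in _ <= X]hnormB_sqr hnormZr rdotZr rdotBl rdotZl rdotix rdotAix.
have -> : hnorm ('i%C *: x) = hnorm x.
  by rewrite hnormZ /cmod normc_def /= expr0n expr1n add0r sqrtr1 mul1r.
by rewrite mulr0 subr0 !mulr0 subr0 lerDr sqr_ge0.
Qed.

End RealInner.

(** * Polynomials of an operator *)

Section OpPoly.
Context {R : realType} {H : normedModType R[i]}.
Implicit Types (x y : H) (z : R[i]) (A B T : H -> H) (p q : {poly R[i]}).

(** Complex coefficients are allowed, unlike in [op_horner], because polynomials are split into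
    linear factors below. *)
Definition opeval p A x : H := \sum_(i < size p) p`_i *: iter i A x.

Lemma opeval_widen p A x n : (size p <= n)%N ->
  opeval p A x = \sum_(i < n) p`_i *: iter i A x.
Proof.
move=> pn; rewrite /opeval (big_ord_widen n (fun i => p`_i *: iter i A x))// big_mkcond.
by apply: eq_bigr => i _; case: ltnP => // /(nth_default 0) ->; rewrite scale0r.
Qed.

Lemma opevalD p q A x : opeval (p + q) A x = opeval p A x + opeval q A x.
Proof.
rewrite (opeval_widen A x (size_polyD p q)) (opeval_widen A x (leq_maxl _ (size q))).
rewrite (opeval_widen A x (leq_maxr (size p) _)).
by rewrite -big_split; apply: eq_bigr => i _; rewrite coefD scalerDl.
Qed.

Lemma opevalZ z p A x : opeval (z *: p) A x = z *: opeval p A x.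
Proof.
rewrite (@opeval_widen _ A x (size p)) ?size_scale_leq// scaler_sumr.
by apply: eq_bigr => i _; rewrite coefZ scalerA.
Qed.

Lemma opevalB p q A x : opeval (p - q) A x = opeval p A x - opeval q A x.
Proof. by rewrite -scaleN1r opevalD opevalZ scaleN1r. Qed.

Lemma opevalC z A x : opeval z%:P A x = z *: x.
Proof. by rewrite (@opeval_widen _ A x 1) ?size_polyC_leq1// big_ord1 coefC. Qed.

Lemma opevalMX p A x : opeval (p * 'X) A x = opeval p A (A x).
Proof.
rewrite (@opeval_widen (p * 'X) A x (size p).+1); last first.
  by apply: (leq_trans (size_polyMleq _ _)); rewrite size_polyX addn2.
rewrite big_ord_recl coefMX scale0r add0r.
by apply: eq_bigr => i _; rewrite coefMX /= -iterSr.
Qed.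

Lemma opevalXB z A x : opeval ('X - z%:P) A x = A x - z *: x.
Proof. by rewrite opevalB -['X]mul1r opevalMX -[1]polyC1 !opevalC scale1r. Qed.

Section Linear.
Variable A : H -> H.
Hypothesis linA : linear A.

Lemma lin_iter n : linear (iter n A).
Proof. by elim: n => [|n IH] a u v //=; rewrite IH linA. Qed.

Lemma opeval_comm p x : opeval p A (A x) = A (opeval p A x).
Proof.
rewrite /opeval (lin_sum linA); apply: eq_bigr => i _.
by rewrite (linZ linA) -iterSr.
Qed.

Lemma opevalM p q x : opeval (p * q) A x = opeval p A (opeval q A x).
Proof.
elim/poly_ind: p x => [|p c IH] x; first by rewrite mul0r -[0]polyC0 !opevalC !scale0r.
rewrite mulrDl mulrAC mul_polyC opevalD opevalMX opevalZ IH opevalD opevalMX opevalC.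
by rewrite opeval_comm.
Qed.

Lemma opeval_bounded p : bounded_operators A -> bounded_operators (opeval p A).
Proof.
move=> hA; elim/poly_ind: p => [|p c IH].
  rewrite -[0]polyC0 (_ : opeval _ _ = 0 *: id); first exact/bounded_scale/bounded_id.
  by apply/funext => x; rewrite opevalC.
rewrite (_ : opeval _ _ = opeval p A \o A + c *: id); last first.
  by apply/funext => x; rewrite opevalD opevalMX opevalC.
by apply: bounded_add; [exact: bounded_comp|exact/bounded_scale/bounded_id].
Qed.

End Linear.

(** Lower bounds multiply under composition. Read contrapositively, this is the part of spectral
    mapping that is used: a product not bounded below has a factor not bounded below. *)
Lemma opeval_factor_bounded_below A (s : seq R[i]) : linear A ->
  (forall z, z \in s -> bounded_below (A - z *: id)) ->
  bounded_below (opeval (\prod_(z <- s) ('X - z%:P)) A).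
Proof.
move=> linA; elim: s => [_|z s IH h].
  by exists 1 => // x; rewrite big_nil opevalC scale1r mul1r.
have [d d0 hd] := IH (fun w ws => h w (mem_behead (s := z :: s) ws)).
have [e e0 he] := h z (mem_head _ _).
exists (d * e) => [|x]; first exact: mulr_gt0.
rewrite big_cons opevalM// opevalXB.
by apply: le_trans (he _); rewrite (mulrC d) -mulrA ler_pM2l.
Qed.

End OpPoly.

(** * Spectrum and functional calculus *)

Section Spectral.
Context {R : realType} {H : normedModType R[i]} (dot : {dot H for Num.conj}).
Hypothesis normE : forall x : H, `|x| ^+ 2 = dot x x.
Implicit Types (x y : H) (z : R[i]) (A B S T : H -> H) (p q : {poly R}).

Local Notation "p ^:C" := (map_poly (real_complex R) p) (at level 2, format "p ^:C").

Lemma opnormD A B : bounded_operators A -> bounded_operators B ->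
  opnorm (A + B) <= opnorm A + opnorm B.
Proof.
move=> hA hB; apply: opnorm_le => [||x]; first exact: bounded_add.
  by rewrite addr_ge0 ?opnorm_ge0.
by rewrite !fctE mulrDl (le_trans (hnormD _ _))// lerD ?le_opnorm.
Qed.

Lemma opnorm_subC A B : opnorm (A - B) = opnorm (B - A).
Proof.
by rewrite /opnorm; congr sup; apply/seteqP; split=> _ [x x1 <-]; exists x => //;
  rewrite !fctE distrC.
Qed.

Lemma opnorm_eq0 A : bounded_operators A -> opnorm A <= 0 -> A = 0.
Proof.
move=> hA A0; apply/funext => x; apply: hnorm_le0.
by apply: (le_trans (le_opnorm x hA)); rewrite mulr_le0_ge0 ?hnorm_ge0.
Qed.

Lemma op_hornerE p A : op_horner p A = opeval p^:C A.
Proof.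
apply/funext => x; rewrite /op_horner /opeval fct_sumE size_map_poly.
by apply: eq_bigr => i _; rewrite coef_map.
Qed.

Lemma op_hornerB p q A : op_horner (p - q) A = op_horner p A - op_horner q A.
Proof. by apply/funext => x; rewrite !fctE !op_hornerE rmorphB opevalB. Qed.

Lemma op_horner_bounded p A : bounded_operators A -> bounded_operators (op_horner p A).
Proof. by move=> hA; rewrite op_hornerE; exact: opeval_bounded. Qed.

Lemma op_horner_selfadj p A : selfadj dot A -> linear A -> selfadj dot (op_horner p A).
Proof.
move=> saA linA; elim/poly_ind: p => [|p c IH] x y; rewrite !op_hornerE.
  by rewrite rmorph0 -[0]polyC0 !opevalC [0](rmorph0 (real_complex R)) rdotZl rdotZr.
rewrite rmorphD rmorphM /= map_polyX map_polyC !opevalD !opevalMX !opevalC.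
rewrite rdotDl rdotDr rdotZl rdotZr -!op_hornerE IH saA !op_hornerE.
by rewrite opeval_comm.
Qed.

Lemma approx_eigenvalue_spectrum A z : ~ bounded_below (A - z *: id) -> spectrum A z.
Proof. by move=> nbb /invertible_bounded_below. Qed.

(** Factor p - p(t) = q (X - t). Then |q(A) (A - t) x| >= (|p(t)| - |p(A)|) |x|, and dividing by a
    bound K of q(A) bounds A - t below. *)
Lemma opnorm_lt_horner_bounded_below A (t : R) p : bounded_operators A ->
  opnorm (op_horner p A) < `|p.[t]| -> bounded_below (A - t%:C *: id).
Proof.
move=> hA plt.
have /factor_theorem[q qE] : root (p - p.[t]%:P) t by rewrite /root !hornerE subrr.
have /boundedP[_ [K K0 hK]] := op_horner_bounded q hA.
exists ((`|p.[t]| - opnorm (op_horner p A)) / K) => [|x].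
  by rewrite divr_gt0// subr_gt0.
rewrite mulrAC ler_pdivrMr// mulrC [X in _ <= X]mulrC.
have -> : hnorm ((A - t%:C *: id) x) = hnorm (opeval ('X - t%:P)^:C A x).
  by rewrite rmorphB /= map_polyX map_polyC opevalXB.
apply: le_trans (hK _); rewrite (op_hornerE q) -(opevalM (bounded_lin hA)) -rmorphM -qE.
rewrite rmorphB /= map_polyC opevalB opevalC hnormBC.
apply: le_trans (hnormBB _ _); rewrite hnormZr mulrC mulrBl lerB// -op_hornerE.
exact: le_opnorm (op_horner_bounded p hA).
Qed.

Lemma opnorm_horner_ge A (t : R) p : bounded_operators A ->
  ~ bounded_below (A - t%:C *: id) -> `|p.[t]| <= opnorm (op_horner p A).
Proof. by move=> hA nbb; rewrite leNgt; apply/negP => /(opnorm_lt_horner_bounded_below hA). Qed.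

Lemma opnorm_horner_le A q (K : R) : bounded_operators A -> selfadj dot A ->
    (exists t : R, spectrum A t%:C) -> 0 <= K ->
    (forall t : R, spectrum A t%:C -> `|q.[t]| <= K) ->
  opnorm (op_horner q A) <= K.
Proof.
move=> hA saA [t0 ht0] K0 hK; rewrite leNgt; apply/negP.
set r := opnorm _ => Kr; have r0 : 0 < r := le_lt_trans K0 Kr.
have linA := bounded_lin hA.
have [] := opnorm_sqr_attained normE (op_horner_selfadj q saA linA) (op_horner_bounded q hA) r0.
rewrite -/r; set P := q * q - (r ^+ 2)%:P.
have -> : op_horner q A \o op_horner q A - (r ^+ 2)%:C *: id = opeval P^:C A.
  apply/funext => x; rewrite /P rmorphB /= [map_poly _ (q * q)]rmorphM /= map_polyC opevalB opevalC.
  by rewrite opevalM// -!op_hornerE.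
have Pt t : spectrum A t%:C -> P.[t] < 0.
  move=> /hK qK; rewrite /P !hornerE subr_lt0 -expr2 -[q.[t] ^+ 2]real_normK ?num_real//.
  by rewrite ltrXn2r// ?(le_lt_trans qK)// ?nnegrE ?(ltW r0).
have [s sE] := closed_field_poly_normal P^:C.
(* The real spectrum is nonempty and P is negative on it. *)
have P0 : P != 0 by apply: contraTneq (Pt _ ht0) => ->; rewrite horner0 ltxx.
have lc0 : lead_coef P^:C != 0 by rewrite lead_coef_eq0 map_poly_eq0.
have : bounded_below (opeval (\prod_(z <- s) ('X - z%:P)) A).
  (* A factor that fails this has a real z in the spectrum, where P(z) = 0 contradicts [Pt]. *)
  apply: opeval_factor_bounded_below => // z zs; apply: contrapT => nbb.
  have zR : z = (complex.Re z)%:C.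
    by have := selfadj_spectrum_real normE saA linA nbb; case: z {zs nbb} => a b /= ->.
  have : root P^:C z by rewrite sE rootZ// root_prod_XsubC.
  rewrite zR fmorph_root /root; apply/negP.
  by rewrite lt_eqF// Pt// -zR; exact: approx_eigenvalue_spectrum.
move=> [d d0 hd]; rewrite sE; exists (cmod (lead_coef P^:C) * d) => [|x].
  by rewrite mulr_gt0// cmod_gt0.
by rewrite opevalZ hnormZ -mulrA ler_wpM2l ?cmod_ge0.
Qed.

Lemma is_fun_calcB (f g : R -> R) A S T : bounded_operators A ->
  is_fun_calc f A S -> is_fun_calc g A T -> is_fun_calc (f - g) A (S - T).
Proof.
move=> hA [hS fS] [hT gT]; split=> [|e e0]; first exact: bounded_sub.
have [p [pf pS]] := fS _ (divr_gt0 e0 (ltr0n R 2)).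
have [q [qg qT]] := gT _ (divr_gt0 e0 (ltr0n R 2)).
exists (p - q); split=> [t ts|].
  rewrite !hornerE (_ : _ - _ = (p.[t] - f t) - (q.[t] - g t)); last by rewrite !fctE; ring.
  by rewrite (le_trans (ler_normB _ _))// [e]splitr lerD ?pf ?qg.
rewrite op_hornerB (_ : _ - _ = (op_horner p A - S) + (T - op_horner q A)); last first.
  by rewrite opprB addrACA [in RHS]addrACA [- S - _]addrC.
apply: le_trans (opnormD _ _) _; try exact: bounded_sub (op_horner_bounded _ _) _.
  by apply: bounded_sub => //; exact: op_horner_bounded.
by rewrite [e]splitr lerD// opnorm_subC.
Qed.

(** The bound for polynomials passes to the norm limit, with e / 2 spent on f and e / 2 on S. The
    lower bound that follows is obtained in the same way. *)
Lemma opnorm_fun_calc_le (f : R -> R) A S (L : R) : bounded_operators A -> selfadj dot A ->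
    (exists t : R, spectrum A t%:C) -> 0 <= L ->
    (forall t : R, spectrum A t%:C -> `|f t| <= L) ->
  is_fun_calc f A S -> opnorm S <= L.
Proof.
move=> hA saA sp0 L0 hL [hS fS]; apply/ler_addgt0Pr => e e0.
have [p [pf pS]] := fS _ (divr_gt0 e0 (ltr0n R 2)).
have hp := op_horner_bounded p hA.
have -> : S = op_horner p A + (S - op_horner p A) by rewrite addrC subrK.
apply: le_trans (opnormD hp (bounded_sub hS hp)) _.
rewrite [e]splitr addrA lerD//; last by rewrite opnorm_subC.
apply: opnorm_horner_le => // [|t ts]; first by rewrite addr_ge0// divr_ge0// ltW.
have -> : p.[t] = f t + (p.[t] - f t) by ring.
by rewrite (le_trans (ler_normD _ _))// lerD ?hL ?pf.
Qed.

Lemma opnorm_fun_calc_ge (f : R -> R) A S (t : R) : bounded_operators A ->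
  ~ bounded_below (A - t%:C *: id) -> is_fun_calc f A S -> `|f t| <= opnorm S.
Proof.
move=> hA nbb [hS fS]; apply/ler_addgt0Pr => e e0.
have [p [pf pS]] := fS _ (divr_gt0 e0 (ltr0n R 2)).
have hp := op_horner_bounded p hA.
have -> : f t = p.[t] - (p.[t] - f t) by ring.
apply: le_trans (ler_normB _ _) _; rewrite [e]splitr addrA lerD//; last first.
  by apply: pf; exact: approx_eigenvalue_spectrum.
apply: le_trans (opnorm_horner_ge p hA nbb) _.
have -> : op_horner p A = S + (op_horner p A - S) by rewrite addrC subrK.
by apply: le_trans (opnormD hS (bounded_sub hp hS)) _; rewrite lerD.
Qed.

(** S - T is a value of the calculus at f - f = 0, hence has norm 0. This identifies the value
    chosen by [fun_calc] with one computed by hand. *)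
Lemma is_fun_calc_unique (f : R -> R) A S T : bounded_operators A -> selfadj dot A ->
    (exists t : R, spectrum A t%:C) ->
  is_fun_calc f A S -> is_fun_calc f A T -> S = T.
Proof.
move=> hA saA sp0 hS hT; apply/eqP; rewrite -subr_eq0; apply/eqP/opnorm_eq0.
  by apply: bounded_sub; [case: hS|case: hT].
apply: opnorm_fun_calc_le hA saA sp0 _ _ (is_fun_calcB hA hS hT) => // t _.
by rewrite subrr normr0.
Qed.

(** On a spectrum of at most one point f agrees with a constant polynomial, so no limit is taken. *)
Lemma is_fun_calc_scalar (f : R -> R) (c : R) :
  spectrum (c%:C *: @id H) `<=` [set c%:C] ->
  is_fun_calc f (c%:C *: @id H) ((f c)%:C *: id).
Proof.
move=> sc; split=> [|e e0]; first exact/bounded_scale/bounded_id.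
exists (f c)%:P; split=> [t /sc [->]|].
  by rewrite hornerC subrr normr0 ltW.
rewrite (_ : op_horner _ _ = (f c)%:C *: id); last first.
  by apply/funext => x; rewrite op_hornerE map_polyC opevalC.
rewrite subrr opnorm_le ?(ltW e0)// => [|x].
  by rewrite -(scale0r (@id H)); exact/bounded_scale/bounded_id.
by rewrite hnorm0 mulr_ge0 ?hnorm_ge0 ?ltW.
Qed.

Lemma spectrum_scalar (z : R[i]) : spectrum (z *: @id H) `<=` [set z].
Proof.
move=> w /= ninv; apply: contrapT => /eqP wz; apply: ninv.
rewrite -scalerBl; have zw0 : z - w != 0 by rewrite subr_eq0 eq_sym.
exists ((z - w)^-1 *: id); split; first exact/bounded_scale/bounded_id.
  by apply/funext => x /=; rewrite !fctE scalerA mulVf// scale1r.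
by apply/funext => x /=; rewrite !fctE scalerA mulfV// scale1r.
Qed.

End Spectral.

(** * Operator power series *)

Section Series.
Context {R : realType} {H : completeNormedModType R[i]}.
Implicit Types (x y : H) (E A S : H -> H).

Lemma expr_small (q e : R) : 0 <= q < 1 -> 0 < e -> exists n, q ^+ n <= e.
Proof.
move=> /andP[q0 q1] e0.
have /cvgrPdist_le/(_ e e0)[n _ /(_ n (leqnn n))] : (fun n => q ^+ n) @ \oo --> (0 : R).
  by apply: cvg_expr; rewrite ger0_norm.
by rewrite /= sub0r normrN ger0_norm ?exprn_ge0// => h; exists n.
Qed.

(** Identities between limits are proved by applying this to the norm of a difference. *)
Lemma squeeze_expr (q M r : R) : 0 <= q < 1 -> 0 <= M ->
  (forall n, r <= q ^+ n * M) -> r <= 0.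
Proof.
move=> q01 M0 h; apply/ler_addgt0Pr => e e0.
have M1 : 0 < M + 1 by rewrite ltr_wpDl.
have [n hn] := expr_small q01 (divr_gt0 e0 M1).
apply: (le_trans (h n)); rewrite add0r.
apply: (@le_trans _ _ (q ^+ n * (M + 1))).
  by rewrite ler_wpM2l ?exprn_ge0 ?lerDl//; case/andP: q01.
by rewrite -ler_pdivlMr.
Qed.

Lemma cauchy_expr_limit (u : nat -> H) (q M : R) : 0 <= q < 1 -> 0 <= M ->
    (forall n m, hnorm (u (n + m)%N - u n) <= q ^+ n * M) ->
  exists l, forall n, hnorm (u n - l) <= q ^+ n * M.
Proof.
move=> q01 M0 hu.
have cu : cvg (u @ \oo).
  (* The radius lives in [R[i]]; its positivity makes it real. *)
  apply/cauchy_cvgP/cauchy_exP => e; case: e => e e'.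
  rewrite ltcE /= => /andP[/eqP -> e0].
  have M1 : 0 < M + 1 by rewrite ltr_wpDl.
  have [n hn] := expr_small q01 (divr_gt0 e0 M1).
  exists (u n); exists n => // m /= nm; rewrite -ball_normE /=.
  rewrite distrC hnormE (_ : Complex e 0 = e%:C)// ltcR -(subnKC nm).
  apply: (le_lt_trans (hu _ _)); have [->|M00] := eqVneq M 0; first by rewrite mulr0.
  apply: (@le_lt_trans _ _ (e / (M + 1) * M)); first by rewrite ler_wpM2r.
  by rewrite mulrAC ltr_pdivrMr// ltr_pM2l// ltrDl.
exists (lim (u @ \oo)) => n; apply/ler_addgt0Pr => e e0.
have e0' : 0 < e%:C :> R[i] by rewrite ltcR.
have /cvgrPdist_le/(_ _ e0')[N _ /(_ (n + N)%N (leq_addl _ _))] := cu.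
rewrite /= hnormE lecR hnormBC => h.
rewrite (_ : u n - _ = (u (n + N)%N - lim (u @ \oo)) - (u (n + N)%N - u n)); last first.
  by rewrite opprB [RHS]addrC addrA subrK.
by apply: (le_trans (hnormB _ _)); rewrite addrC lerD.
Qed.

(** The series is dominated by a geometric one. It serves twice: c = 1 gives the Neumann series, c k
    = 1 / k the logarithm. *)
Lemma geometric_op_series E (q : R) (c : nat -> R) : linear E -> 0 <= q < 1 ->
    (forall x, hnorm (E x) <= q * hnorm x) -> (forall k, `|c k| <= 1) ->
  exists2 S, bounded_operators S & forall n x,
    hnorm (\sum_(k < n) (c k)%:C *: iter k E x - S x) <= q ^+ n * ((1 - q)^-1 * hnorm x).
Proof.
move=> linE q01 hE c1; have [q0 q1] := andP q01.
have q1' : 0 < 1 - q by rewrite subr_gt0.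
pose u x n := \sum_(k < n) (c k)%:C *: iter k E x.
have iterE k x : hnorm (iter k E x) <= q ^+ k * hnorm x.
  elim: k => [|k IH]; first by rewrite mul1r.
  by rewrite exprS -mulrA; apply: (le_trans (hE _)); rewrite ler_wpM2l.
(* Keeping the exact geometric tail q^n - q^(n + m) lets the induction on m close. *)
have uD x n m : hnorm (u x (n + m)%N - u x n) <= (q ^+ n - q ^+ (n + m)) * ((1 - q)^-1 * hnorm x).
  elim: m => [|m IH]; first by rewrite addn0 !subrr hnorm0 mul0r.
  rewrite addnS /u big_ord_recr /= -/(u x (n + m)%N) -/(u x n) addrAC.
  apply: (le_trans (hnormD _ _)).
  have -> : (q ^+ n - q ^+ (n + m).+1) * ((1 - q)^-1 * hnorm x) =
     (q ^+ n - q ^+ (n + m)) * ((1 - q)^-1 * hnorm x) + q ^+ (n + m) * hnorm x.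
    by rewrite exprS; field; rewrite gt_eqF.
  rewrite lerD// hnormZr; apply: (le_trans _ (iterE _ _)).
  by rewrite ler_piMl ?hnorm_ge0.
have /choice[S hS] x : exists l, forall n, hnorm (u x n - l) <= q ^+ n * ((1 - q)^-1 * hnorm x).
  apply: cauchy_expr_limit => // [|n m]; first by rewrite mulr_ge0 ?invr_ge0 ?hnorm_ge0 ?ltW.
  apply: (le_trans (uD _ _ _)); rewrite ler_wpM2r ?mulr_ge0 ?invr_ge0 ?hnorm_ge0 ?(ltW q1')//.
  by rewrite gerBl exprn_ge0.
have u0 x : 0 <= (1 - q)^-1 * hnorm x by rewrite mulr_ge0 ?invr_ge0 ?hnorm_ge0 ?ltW.
exists S; last by move=> n x; exact: hS.
apply/boundedP; split=> [a x y|].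
  (* S was chosen pointwise, so its linearity is inherited from the partial sums through the error
     bounds. *)
  apply/eqP; rewrite -subr_eq0; apply/eqP/hnorm_le0.
  pose M := (1 - q)^-1 * hnorm (a *: x + y) + cmod a * ((1 - q)^-1 * hnorm x) +
            (1 - q)^-1 * hnorm y.
  apply: (@squeeze_expr q M) => // [|n]; first by rewrite !addr_ge0// mulr_ge0 ?cmod_ge0.
  have uP : u (a *: x + y) n = a *: u x n + u y n.
    rewrite /u scaler_sumr -big_split /=; apply: eq_bigr => k _.
    by rewrite (lin_iter linE) scalerDr !scalerA mulrC.
  rewrite (_ : S _ - _ = - (u (a *: x + y) n - S (a *: x + y)) + a *: (u x n - S x) +
                         (u y n - S y)); last first.
    by rewrite uP scalerBr opprB -[RHS]addrA [a *: u x n - _ + _]addrACA [RHS]addrA subrK -opprD.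
  rewrite /M !mulrDr; apply: (le_trans (hnormD _ _)); rewrite lerD//.
  apply: (le_trans (hnormD _ _)); rewrite hnormN lerD//.
  by rewrite hnormZ mulrCA ler_wpM2l ?cmod_ge0.
exists (1 - q)^-1; first by rewrite invr_gt0.
by move=> x; have := hS x 0; rewrite /u big_ord0 sub0r hnormN mul1r.
Qed.

End Series.

(** * Neumann series and the norm bound on the real spectrum *)

Section Neumann.
Context {R : realType} {H : completeNormedModType R[i]}.
Implicit Types (x y : H) (z : R[i]) (E A B S : H -> H).

Lemma is_inverse_scale z A B : z != 0 -> linear A -> is_inverse A B ->
  is_inverse (z *: A) (z^-1 *: B).
Proof.
move=> z0 linA [hB BA AB]; have linB := bounded_lin hB.
have BAx x : B (A x) = x by exact: (congr1 (@^~ x) BA).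
have ABx x : A (B x) = x by exact: (congr1 (@^~ x) AB).
split; first exact: bounded_scale.
  by apply/funext => x /=; rewrite !fctE (linZ linB) BAx scalerA mulVf// scale1r.
by apply/funext => x /=; rewrite !fctE (linZ linA) ABx scalerA mulfV// scale1r.
Qed.

Lemma invertible_scale z A : z != 0 -> linear A -> invertible A -> invertible (z *: A).
Proof. by move=> z0 linA [B hB]; exists (z^-1 *: B); exact: is_inverse_scale. Qed.

(** The inverse is the sum S of the powers of E. Its partial sums satisfy P (n + 1) = 1 + E P n = 1
    + P n E, and both recursions pass to the limit. *)
Lemma neumann E (q : R) : linear E -> 0 <= q < 1 ->
  (forall x, hnorm (E x) <= q * hnorm x) -> invertible (id - E).
Proof.
move=> linE q01 hE; have [q0 q1] := andP q01.
have q1' : 0 < 1 - q by rewrite subr_gt0.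
have [|S hS SP] := @geometric_op_series _ _ E q (fun=> 1) linE q01 hE.
  by move=> _; rewrite normr1.
have linS := bounded_lin hS.
pose P n x : H := \sum_(k < n) iter k E x.
pose C x : R := (1 - q)^-1 * hnorm x.
have C0 x : 0 <= C x by rewrite mulr_ge0 ?invr_ge0 ?hnorm_ge0 ?ltW.
have PS n x : hnorm (P n x - S x) <= q ^+ n * C x.
  by apply: le_trans (SP n x); rewrite /P; under [in leRHS]eq_bigr do rewrite scale1r.
have PE n x : P n.+1 x = x + E (P n x).
  by rewrite /P big_ord_recl /= (lin_sum linE).
have PE' n x : P n.+1 x = x + P n (E x).
  by rewrite PE /P (lin_sum linE); congr (_ + _); apply: eq_bigr => k _; rewrite -iterSr.
have qS n x : q ^+ n.+1 * C x <= q ^+ n * C x.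
  by rewrite ler_wpM2r// exprS ler_piMl ?exprn_ge0// ltW.
exists S; split=> //; apply/funext => x /=; apply/eqP; rewrite -subr_eq0; apply/eqP/hnorm_le0.
  apply: (@squeeze_expr R q (C x + C (E x))) => // [|n]; first exact: addr_ge0.
  rewrite !fctE (linB linS).
  have -> : S x - S (E x) - x = (P n (E x) - S (E x)) - (P n.+1 x - S x).
    by rewrite PE' opprB [RHS]addrC opprD !addrA subrK addrAC.
  apply: (le_trans (hnormB _ _)); rewrite addrC mulrDr lerD//.
  exact: le_trans (PS _ _) (qS _ _).
apply: (@squeeze_expr R q (C x + q * C x)) => // [|n]; first by rewrite addr_ge0// mulr_ge0.
rewrite !fctE.
have -> : S x - E (S x) - x = E (P n x - S x) - (P n.+1 x - S x).
  by rewrite PE (linB linE) opprB [RHS]addrC opprD !addrA subrK addrAC.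
apply: (le_trans (hnormB _ _)); rewrite addrC mulrDr lerD//.
  exact: le_trans (PS _ _) (qS _ _).
by apply: (le_trans (hE _)); rewrite mulrCA ler_wpM2l.
Qed.

Lemma linear_id_sub A : linear A -> linear (id - A).
Proof. by move=> linA a x y; rewrite !fctE linA scalerBr opprD addrACA. Qed.

(** If |t| > q then E - t = - t (1 - E / t) is inverted by the Neumann series with ratio q / |t|. *)
Lemma spectrum_le E (q t : R) : linear E -> 0 <= q ->
  (forall x, hnorm (E x) <= q * hnorm x) -> spectrum E t%:C -> `|t| <= q.
Proof.
move=> linE q0 hE; apply: contraPle => qt ninv; apply: ninv.
have t0 : 0 < `|t| by apply: le_lt_trans qt.
have tn0 : t != 0 by rewrite -normr_gt0.
rewrite /= (_ : E - t%:C *: id = (- t)%:C *: (id - (t^-1)%:C *: E)); last first.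
  apply/funext => x; rewrite !fctE rmorphN scaleNr scalerBr opprB scalerA -rmorphM mulfV//.
  by rewrite scale1r.
have lin' : linear ((t^-1)%:C *: E).
  by move=> a x y; rewrite !fctE linE scalerDr !scalerA mulrC.
apply: invertible_scale; first by rewrite fmorph_eq0 oppr_eq0.
  exact: linear_id_sub.
apply: (@neumann _ (q / `|t|)) => // [|x].
  by rewrite divr_ge0//= ltr_pdivrMr// mul1r.
by rewrite fctE hnormZr normfV mulrAC [X in _ <= X]mulrC ler_pM2l ?invr_gt0.
Qed.

End Neumann.

(** * The logarithmic series *)

Section LogSeries.
Context {R : realType}.

(** Taylor polynomials of - ln (1 - s); the constant term vanishes because 0^-1 = 0. *)
Definition logpoly n : {poly R} := \poly_(k < n) k%:R^-1.

Lemma logpolyS n : logpoly n.+1 = logpoly n + n%:R^-1 *: 'X^n.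
Proof. by rewrite /logpoly !poly_def big_ord_recr. Qed.

(** The derivative is the geometric sum 1 + s + ... + s^(n - 1), cleared of its denominator. *)
Lemma deriv_logpoly n (s : R) : (1 - s) * (logpoly n.+1)^`().[s] = 1 - s ^+ n.
Proof.
elim: n => [|n IH].
  rewrite logpolyS /logpoly poly_def big_ord0 add0r invr0 scale0r deriv0 horner0.
  by rewrite mulr0 expr0 subrr.
rewrite logpolyS derivD hornerD mulrDr IH derivZ derivXn /= hornerZ hornerMn hornerXn.
by rewrite -[s ^+ n *+ _]mulr_natl mulKf ?pnatr_eq0// exprS; ring.
Qed.

Lemma is_derive_logpoly_ln n (s : R) : s < 1 ->
  is_derive s 1 (fun u => (logpoly n.+1).[u] + ln (1 - u)) (- s ^+ n / (1 - s)).
Proof.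
move=> s1; have s1' : 0 < 1 - s by rewrite subr_gt0.
have dl : is_derive s 1 (fun u : R => 1 - u) (- 1).
  by have := is_deriveB (is_derive_cst (1 : R) s 1) (is_derive_id s 1); rewrite sub0r.
have dln := is_derive1_ln s1'.
have := is_deriveD (is_derive_poly (logpoly n.+1) s)
  (@is_derive1_comp R (@ln R) (fun u => 1 - u) s _ _ dln dl).
congr is_derive.
rewrite mulrN1; apply: (mulfI (lt0r_neq0 s1')).
by rewrite mulrBr deriv_logpoly; field; rewrite gt_eqF.
Qed.

(** The remainder vanishes at 0, so by the mean value theorem it is s times - c^n / (1 - c) for some
    c between 0 and s; here c <= q and s <= 1. *)
Lemma ln_series_remainder n (q s : R) : 0 <= s <= q -> q < 1 ->
  `|(logpoly n.+1).[s] + ln (1 - s)| <= q ^+ n / (1 - q).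
Proof.
move=> /andP[s0 sq] q1; have q0 := le_trans s0 sq.
have q1' : 0 < 1 - q by rewrite subr_gt0.
have P0 : (logpoly n.+1).[0] + ln (1 - 0) = 0.
  by rewrite subr0 ln1 addr0 horner_coef0 coef_poly /= invr0.
have [->|sn0] := eqVneq s 0.
  by rewrite P0 normr0 divr_ge0 ?exprn_ge0 ?(ltW q1').
have s0' : 0 < s by rewrite lt0r sn0.
pose f u : R := (logpoly n.+1).[u] + ln (1 - u).
have df (u : R) : u <= s -> is_derive u 1 f (- u ^+ n / (1 - u)).
  by move=> us; apply: is_derive_logpoly_ln; exact: le_lt_trans (le_trans us sq) q1.
have [|| c] := @MVT R f (fun u => - u ^+ n / (1 - u)) 0 s s0'.
- by move=> x; rewrite in_itv /= => /andP[_ /ltW xs]; exact: df.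
- apply: derivable_within_continuous => x; rewrite in_itv /= => /andP[_ xs].
  by have [] := df x xs.
rewrite in_itv /= => /andP[c0 cs]; rewrite {1 2}/f P0 !subr0 => ->.
have c1 : 0 < 1 - c by rewrite subr_gt0 (lt_trans cs)// (le_lt_trans sq).
rewrite !normrM normrN normfV normrX !ger0_norm ?(ltW c0) ?(ltW c1) ?(ltW s0')//.
rewrite -[leRHS]mulr1 ler_pM ?(ltW s0')//.
- by rewrite divr_ge0 ?exprn_ge0 ?ltW.
- rewrite ler_pM ?exprn_ge0 ?invr_ge0 ?(ltW c0) ?(ltW c1)//.
    by rewrite lerXn2r ?nnegrE ?(ltW c0)// ltW// (lt_le_trans cs).
  by rewrite lef_pV2 ?posrE// lerD2l lerN2 ltW// (lt_le_trans cs).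
- by rewrite ltW// (le_lt_trans sq).
Qed.

End LogSeries.

(** * Positive invertible operators *)

Section PositiveOperators.
Context {R : realType} {H : completeNormedModType R[i]} (dot : {dot H for Num.conj}).
Hypothesis normE : forall x : H, `|x| ^+ 2 = dot x x.
Implicit Types (x y : H) (z : R[i]) (A B S : H -> H).

(** Turns the logarithmic polynomial in E = r(A) into a polynomial in A. *)
Lemma opeval_comp (p r : {poly R[i]}) A x : linear A ->
  opeval (p \Po r) A x = opeval p (opeval r A) x.
Proof.
move=> linA; elim/poly_ind: p x => [|p c IH] x; first by rewrite comp_poly0 -[0]polyC0 !opevalC.
by rewrite comp_poly_MXaddC !opevalD opevalMX opevalM// !opevalC IH.
Qed.

Section Nontrivial.
Variable v0 : H.
Hypothesis v0_neq0 : v0 != 0.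

Lemma pos_invertible_scale (l : R) A : 0 < l ->
  pos_invertible dot A -> pos_invertible dot (l%:C *: A).
Proof.
move=> l0 [hA posA iA]; split; first exact: bounded_scale.
  by move=> x; rewrite fctE dotZl mulr_ge0// (lecR 0) ltW.
apply: invertible_scale iA; first by rewrite fmorph_eq0 gt_eqF.
exact: bounded_lin hA.
Qed.

Lemma opinv_bounded A : invertible A -> bounded_operators (opinv A).
Proof. by move=> /opinvP[]. Qed.

Lemma opinvK A x : invertible A -> A (opinv A x) = x.
Proof. by move=> /opinvP[_ _ AB]; exact: (congr1 (@^~ x) AB). Qed.

Lemma opinvKV A x : invertible A -> opinv A (A x) = x.
Proof. by move=> /opinvP[_ BA _]; exact: (congr1 (@^~ x) BA). Qed.

Lemma opnorm_gt0 A x : bounded_operators A -> A x != 0 -> 0 < opnorm A.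
Proof.
move=> hA Ax0; have := lt_le_trans (hnorm_gt0 Ax0) (le_opnorm x hA).
by apply: contraTT; rewrite -!leNgt => h; rewrite mulr_le0_ge0 ?hnorm_ge0.
Qed.

Lemma opnorm_pos_invertible_gt0 A : pos_invertible dot A -> 0 < opnorm A.
Proof.
move=> [hA _ iA]; apply: (@opnorm_gt0 _ (opinv A v0)) => //.
by rewrite opinvK.
Qed.

Lemma opnorm_opinv_gt0 A : pos_invertible dot A -> 0 < opnorm (opinv A).
Proof.
move=> [hA _ iA]; apply: (@opnorm_gt0 _ (A v0)); first exact: opinv_bounded.
by rewrite opinvKV.
Qed.

Lemma opinv_scale (l : R) A : 0 < l -> pos_invertible dot A ->
  opinv (l%:C *: A) = (l^-1)%:C *: opinv A.
Proof.
move=> l0 [hA _ iA]; apply: opinvE; rewrite fmorphV.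
apply: is_inverse_scale; first by rewrite fmorph_eq0 gt_eqF.
  exact: bounded_lin hA.
exact: opinvP.
Qed.

Section Positive.
Variable A : H -> H.
Hypothesis posA : pos_invertible dot A.

Let M := opnorm A.
Let N := opnorm (opinv A).

Let hA : bounded_operators A. Proof. by case: posA. Qed.
Let iA : invertible A. Proof. by case: posA. Qed.
Let linA : linear A. Proof. exact: bounded_lin. Qed.
Let saA : selfadj dot A. Proof. by case: posA => _ + _; exact: positive_selfadj. Qed.
Let A_ge0 x : 0 <= rdot dot (A x) x.
Proof. by case: posA => _ + _ => /positive_rdot_ge0; exact. Qed.
Let M0 : 0 < M. Proof. exact: opnorm_pos_invertible_gt0. Qed.
Let N0 : 0 < N. Proof. exact: opnorm_opinv_gt0. Qed.

Let hC : bounded_operators (opinv A). Proof. exact: opinv_bounded. Qed.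

Let saC : selfadj dot (opinv A).
Proof. by move=> x y; rewrite -{2}[x](opinvK x iA) saA opinvK. Qed.

Let C_ge0 x : 0 <= rdot dot (opinv A x) x.
Proof. by rewrite saC -{1}[x](opinvK x iA). Qed.

Let rdot_opnorm_le B x : bounded_operators B ->
  rdot dot (B x) x <= opnorm B * hnorm x ^+ 2.
Proof.
move=> hB; apply: (le_trans (rdot_le normE _ _)).
by rewrite expr2 mulrA ler_wpM2r ?hnorm_ge0// le_opnorm.
Qed.

(** This is A >= 1 / N, from [hnorm_selfadj_le] for the inverse of A at the vector A x. *)
Let A_ge x : hnorm x ^+ 2 <= N * rdot dot (A x) x.
Proof.
have := hnorm_selfadj_le normE saC (bounded_lin hC) N0 C_ge0 (fun y => rdot_opnorm_le y hC) (A x).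
by rewrite opinvKV// rdotC.
Qed.

Lemma kappa_ge1 : 1 <= kappa A.
Proof.
rewrite /kappa -/M -/N -(ler_pM2r (hnorm_gt0 v0_neq0)) mul1r.
have /le_trans : hnorm v0 <= N * hnorm (A v0).
  by rewrite -{1}[v0](opinvKV v0 iA) le_opnorm.
by apply; rewrite (mulrC M) -mulrA ler_pM2l// le_opnorm.
Qed.

Let MN1 : 1 <= M * N. Proof. exact: kappa_ge1. Qed.

Lemma opnorm_approx_eigenvalue : ~ bounded_below (A - (opnorm A)%:C *: id).
Proof.
apply: (opnorm_attained normE saA hA M0).
by apply: (hnorm_selfadj_le normE) => // x; exact: rdot_opnorm_le.
Qed.

(** N is an approximate eigenvalue of A^-1, and (A^-1 - N) x = - N (A - N^-1) y with y = A^-1 x. *)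
Lemma opnorm_opinv_approx_eigenvalue :
  ~ bounded_below (A - ((opnorm (opinv A))^-1)%:C *: id).
Proof.
move=> [d d0 hd].
apply: (opnorm_attained normE saC hC N0).
  by apply: (hnorm_selfadj_le normE saC (bounded_lin hC)) => // x; exact: rdot_opnorm_le.
(* N comes from the identity between the two differences, 1 / M from |x| <= M |y|. *)
exists (N * d / M) => [|x]; first by rewrite divr_gt0// mulr_gt0.
set y := opinv A x; have xE : x = A y by rewrite /y opinvK.
have -> : (opinv A - (opnorm (opinv A))%:C *: id) x = (- N)%:C *: (A - (N^-1)%:C *: id) y.
  rewrite {1}xE !fctE opinvKV// scalerBr scalerA -rmorphM mulNr mulfV ?gt_eqF//.
  by rewrite !rmorphN rmorph1 !scaleNr scale1r opprK addrC.
rewrite hnormZr normrN gtr0_norm// mulrAC ler_pdivrMr// -!mulrA ler_pM2l//.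
apply: (@le_trans _ _ (M * (d * hnorm y))); last by rewrite [leRHS]mulrC ler_pM2l// hd.
by rewrite mulrCA ler_pM2l// {1}xE le_opnorm.
Qed.

Let NM : N^-1 <= M.
Proof. by rewrite -[N^-1]mul1r ler_pdivrMr. Qed.

(** Since 0 <= M - A <= M - 1 / N, the norm of M - A is at most q. The inequality on q is strict
    because M = 1 / N for scalar A, while [hnorm_selfadj_le] takes a positive bound. *)
Let comp_bound q : M - N^-1 < q ->
  forall x, hnorm ((M%:C *: id - A) x) <= q * hnorm x.
Proof.
move=> hq x; set D := M%:C *: id - A.
have q0 : 0 < q by apply: le_lt_trans hq; rewrite subr_ge0.
have DE y : D y = M%:C *: y - A y by [].
have linD : linear D.
  move=> a u w; rewrite !DE linA scalerDr scalerBr !scalerA [M%:C * a]mulrC.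
  by rewrite opprD addrACA.
have saD : selfadj dot D.
  by move=> u w; rewrite !DE rdotBl rdotBr rdotZl rdotZr saA.
have DD u : rdot dot (D u) u = M * hnorm u ^+ 2 - rdot dot (A u) u.
  by rewrite DE rdotBl rdotZl rdotxx.
have D0 u : 0 <= rdot dot (D u) u by rewrite DD subr_ge0 rdot_opnorm_le.
have Dq u : rdot dot (D u) u <= q * hnorm u ^+ 2.
  rewrite DD; apply: (@le_trans _ _ ((M - N^-1) * hnorm u ^+ 2)).
    by rewrite mulrBl lerB// -ler_pdivlMl ?invr_gt0// invrK.
  by rewrite ler_wpM2r ?sqr_ge0// ltW.
rewrite -ler_sqr ?nnegrE ?hnorm_ge0 ?mulr_ge0 ?hnorm_ge0 ?(ltW q0)// exprMn.
apply: (le_trans (hnorm_selfadj_le normE saD linD q0 D0 Dq x)).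
by rewrite expr2 -mulrA ler_pM2l.
Qed.

(** The upper bound is |t| <= |A|. For the lower one, M - t lies in the spectrum of M - A, whose
    norm is controlled by [comp_bound]. *)
Lemma spectrum_pos_invertible (t : R) : spectrum A t%:C ->
  (opnorm (opinv A))^-1 <= t <= opnorm A.
Proof.
move=> ts; apply/andP; split; last first.
  apply: (le_trans (ler_norm t)); apply: (spectrum_le linA) => //; first exact: ltW.
  by move=> x; exact: le_opnorm.
rewrite leNgt; apply/negP => tN.
(* The midpoint of M - 1 / N and M - t, hence strictly between them when t < 1 / N. *)
pose q := M - (t + N^-1) / 2.
have qN : M - N^-1 < q by rewrite /q /N ltrD2l ltrN2 ltr_pdivrMr// mulr2n mulrDr mulr1 ltrD2r.
have q0 : 0 <= q.
  by rewrite ltW// (le_lt_trans _ qN)// subr_ge0.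
have linD : linear (M%:C *: id - A).
  by apply: bounded_lin; apply: bounded_sub => //; exact/bounded_scale/bounded_id.
have := spectrum_le linD q0 (comp_bound qN) (t := M - t).
have sD : spectrum (M%:C *: id - A) (M - t)%:C.
  move=> i; apply: ts; have := invertible_scale (z := -1) _ _ i; rewrite scaleN1r.
  rewrite (_ : - (M%:C *: id - A - (M - t)%:C *: id) = A - t%:C *: id); last first.
    apply/funext => x; rewrite !fctE [(M - t)%:C]rmorphB scalerBl opprB (opprB _ (A x)).
    by rewrite [LHS]addrC addrA subrK.
  apply; first by rewrite oppr_eq0 oner_eq0.
  by apply: bounded_lin; apply: bounded_sub;
    [exact: bounded_sub (bounded_scale _ bounded_id) hA|exact: bounded_scale _ bounded_id].
move=> /(_ sD) /(le_trans (ler_norm _)); rewrite /q; move: tN; rewrite -/N; lra.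
Qed.

(** With A = M (1 - E) and |E| < 1, the logarithm is ln M minus the sum of E^k / k. *)
Lemma ex_fun_calc_ln : exists S, is_fun_calc (@ln R) A S.
Proof.
pose E := id - (M^-1)%:C *: A.
(* The norm of E is at most 1 - 1 / (M N); the factor 2 provides the strictness wanted by
   [comp_bound]. *)
pose q := 1 - (2 * (M * N))^-1.
have MN0 : 0 < M * N by rewrite mulr_gt0.
have q01 : 0 <= q < 1.
  rewrite /q subr_ge0 gtrBl invr_gt0 mulr_gt0// andbT invf_le1 ?mulr_gt0//.
  by have := MN1; lra.
have [q0 q1] := andP q01.
have ME : M%:C *: id - A = M%:C *: E.
  by rewrite /E scalerBr scalerA -rmorphM mulfV ?gt_eqF// scale1r.
have hE x : hnorm (E x) <= q * hnorm x.
  have : M - N^-1 < M * q.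
    rewrite /q mulrBr mulr1 ltrD2l ltrN2 invfM mulrCA invfM mulVKf ?gt_eqF//.
    by rewrite gtr_pMl ?invr_gt0// invf_lt1// ltr1n.
  move=> /comp_bound /(_ x); rewrite ME fctE hnormZr (gtr0_norm M0) -mulrA ler_pM2l//.
have hbE : bounded_operators E by apply: bounded_sub; [exact: bounded_id|exact: bounded_scale].
have linE := bounded_lin hbE.
have [|S0 hS0 hS] := geometric_op_series (c := fun k => k%:R^-1) linE q01 hE.
  by case=> [|k]; rewrite ?invr0 ?normr0// normfV invf_le1 ?normr_gt0 ?pnatr_eq0//
    ger0_norm// ler1n.
exists ((ln M)%:C *: id - S0); split=> [|e e0].
  by apply: bounded_sub => //; exact/bounded_scale/bounded_id.
have q1' : 0 < 1 - q by rewrite subr_gt0.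
(* Then q^n / (1 - q) <= e, which serves both the scalar and the operator remainder. *)
have [n qn] := expr_small q01 (mulr_gt0 e0 q1').
pose r : {poly R} := 1 - M^-1 *: 'X.
exists ((ln M)%:P - (logpoly n.+1 \Po r)); split=> [t ts|].
  have /andP[Nt tM] := spectrum_pos_invertible ts.
  have t0 : 0 < t by apply: lt_le_trans Nt; rewrite invr_gt0.
  have rt : r.[t] = 1 - t / M by rewrite /r !hornerE mulrC.
  have -> : ln t = ln M + ln (1 - r.[t]).
    rewrite rt (_ : 1 - _ = t / M); last by ring.
    rewrite -lnM ?posrE ?divr_gt0//.
    by rewrite mulrCA mulfV ?gt_eqF// mulr1.
  rewrite hornerD hornerN hornerC horner_comp.
  rewrite (_ : _ - _ = - ((logpoly n.+1).[r.[t]] + ln (1 - r.[t]))); last by ring.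
  rewrite normrN; apply: (le_trans (ln_series_remainder n (q := q) _ q1)).
    rewrite rt subr_ge0 ler_pdivrMr// mul1r tM /= /q lerD2l lerN2.
    rewrite ler_pdivlMr// (_ : _ * M = N^-1 / 2); last by field; rewrite !gt_eqF.
    by apply: le_trans Nt; rewrite ler_piMr ?invr_ge0 ?(ltW N0)// invf_le1// ler1n.
  by rewrite ler_pdivrMr.
apply: opnorm_le => [||x].
- apply: bounded_sub; first exact: op_horner_bounded.
  by apply: bounded_sub => //; exact/bounded_scale/bounded_id.
- exact: ltW.
have rE : opeval (map_poly (real_complex R) r) A = E.
  apply/funext => y; rewrite /r rmorphB /= map_polyZ map_polyX rmorph1 opevalB opevalZ.
  by rewrite -['X]mul1r opevalMX -[1]polyC1 !opevalC !scale1r.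
have logE : opeval (map_poly (real_complex R) (logpoly n.+1)) E x =
    \sum_(k < n.+1) (k%:R^-1)%:C *: iter k E x.
  rewrite (@opeval_widen _ _ _ _ _ n.+1) ?size_map_poly ?size_poly//.
  by apply: eq_bigr => k _; rewrite coef_map coef_poly ltn_ord.
have -> : (op_horner ((ln M)%:P - (logpoly n.+1 \Po r)) A - ((ln M)%:C *: id - S0)) x =
    - (\sum_(k < n.+1) (k%:R^-1)%:C *: iter k E x - S0 x).
  rewrite !fctE op_hornerE rmorphB /= map_polyC map_comp_poly opevalB opevalC.
  by rewrite opeval_comp// rE logE !opprB [LHS]addrC addrA subrK.
(* The sum has n + 1 terms, counting the zero one at k = 0, so the operator error carries q^(n + 1)
   <= q^n. *)
rewrite hnormN; apply: (le_trans (hS _ _)); rewrite mulrA ler_wpM2r ?hnorm_ge0//.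
rewrite ler_pdivrMr// exprS; apply: le_trans qn.
by rewrite ler_piMl ?exprn_ge0// ltW.
Qed.

End Positive.
End Nontrivial.
End PositiveOperators.

(** * The projective distance to a scalar *)

Section Thompson.
Context {R : realType} {H : completeNormedModType R[i]} (dot : {dot H for Num.conj}).
Hypothesis normE : forall x : H, `|x| ^+ 2 = dot x x.
Implicit Types (x y : H) (z : R[i]) (A B S : H -> H).

Lemma artanh_ratio (k : R) : 0 < k -> artanh ((k - 1) / (k + 1)) = ln k / 2.
Proof.
move=> k0; rewrite /artanh; congr (ln _ / _); field.
by rewrite !gt_eqF//; lra.
Qed.

Section Nontrivial.
Variable v0 : H.
Hypothesis v0_neq0 : v0 != 0.

Lemma spectrum_scalar_self (c : R) : spectrum (c%:C *: @id H) c%:C.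
Proof.
apply: approx_eigenvalue_spectrum => -[d d0 /(_ v0)].
by apply/negP; rewrite subrr -ltNge hnorm0 mulr_gt0// hnorm_gt0.
Qed.

Lemma selfadj_scalar (c : R) : selfadj dot (c%:C *: @id H).
Proof. by move=> x y; rewrite !fctE rdotZl rdotZr. Qed.

(** One argument of the metric is always scalar below, so this is the only inverse square root to
    compute. *)
Lemma op_invsqrt_scalar (c : R) :
  op_invsqrt (c%:C *: @id H) = (c `^ (- 2^-1))%:C *: id.
Proof.
have calc := is_fun_calc_scalar (fun t => t `^ (- 2^-1)) (@spectrum_scalar R H c%:C).
apply: (is_fun_calc_unique normE _ (@selfadj_scalar c) _ _ calc).
- exact/bounded_scale/bounded_id.
- by exists c; exact: spectrum_scalar_self.
- by rewrite /op_invsqrt /fun_calc; apply: xgetPex; exists ((c `^ (- 2^-1))%:C *: id).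
Qed.

Lemma opnorm_oplog A : pos_invertible dot A ->
  opnorm (oplog A) = Num.max `|ln (opnorm A)| `|ln (opnorm (opinv A))|.
Proof.
move=> posA; have [hA dA iA] := posA.
have saA : selfadj dot A by apply: positive_selfadj => //; exact: bounded_lin hA.
have calc : is_fun_calc (@ln R) A (oplog A).
  exact: xgetPex (ex_fun_calc_ln normE v0_neq0 posA).
have nbM := opnorm_approx_eigenvalue normE v0_neq0 posA.
have nbN := opnorm_opinv_approx_eigenvalue normE v0_neq0 posA.
have M0 := opnorm_pos_invertible_gt0 v0_neq0 posA.
have N0 := opnorm_opinv_gt0 v0_neq0 posA.
apply/le_anti/andP; split.
  apply: (opnorm_fun_calc_le normE hA saA _ _ _ calc).
  - by exists (opnorm A); exact: approx_eigenvalue_spectrum.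
  - by rewrite le_max normr_ge0.
  move=> t /(spectrum_pos_invertible normE v0_neq0 posA)/andP[Nt tM].
  have t0 : 0 < t by apply: lt_le_trans Nt; rewrite invr_gt0.
  have lnt : ln t <= ln (opnorm A) by rewrite ler_ln ?posrE.
  have lnNt : - ln (opnorm (opinv A)) <= ln t by rewrite -lnV ?posrE// ler_ln ?posrE ?invr_gt0.
  (* The sign of ln t decides which endpoint of the interval dominates |ln t|. *)
  rewrite le_max; have [lt0|lt0] := leP 0 (ln t).
    by rewrite (ger0_norm lt0) (le_trans lnt (ler_norm _)).
  by rewrite (ltr0_norm lt0) orbC (le_trans _ (ler_norm _))// lerNl.
rewrite ge_max (opnorm_fun_calc_ge hA nbM calc) -[X in X <= _]normrN -lnV ?posrE//.
exact: opnorm_fun_calc_ge hA nbN calc.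
Qed.

(** The sandwiched operator is (l / c) B; scaling adds ln (l / c) to ln |B| and subtracts it from ln
    |B^-1|. *)
Lemma thompson_scalar (c l : R) B : 0 < c -> 0 < l -> pos_invertible dot B ->
  thompson (c%:C *: id) (l%:C *: B) =
  Num.max `|ln (l / c) + ln (opnorm B)| `|ln (opnorm (opinv B)) - ln (l / c)|.
Proof.
move=> c0 l0 posB; have [hB _ _] := posB.
have lc0 : 0 < l / c by rewrite divr_gt0.
have M0 := opnorm_pos_invertible_gt0 v0_neq0 posB.
have N0 := opnorm_opinv_gt0 v0_neq0 posB.
rewrite /thompson op_invsqrt_scalar.
have -> : ((c `^ (- 2^-1))%:C *: id) \o (l%:C *: B) \o ((c `^ (- 2^-1))%:C *: id) = (l / c)%:C *: B.
  apply/funext => x; rewrite /= !fctE (linZ (bounded_lin hB)) !scalerA -!rmorphM.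
  rewrite mulrAC -powRD; last by apply/implyP => _; rewrite gt_eqF.
  by rewrite (_ : - _ + - _ = -1) ?powR_inv1 ?(ltW c0) 1?mulrC//; lra.
rewrite opnorm_oplog; last exact: pos_invertible_scale.
rewrite (opinv_scale lc0 posB) !opnorm_scale//; last by case: posB => _ _ /opinv_bounded.
set u := l / c in lc0 *; have u0 : 0 < u^-1 by rewrite invr_gt0.
rewrite (gtr0_norm lc0) (gtr0_norm u0) (lnM lc0 M0) (lnM u0 N0) (lnV lc0).
by rewrite [- _ + _]addrC.
Qed.

Lemma proj_thompson_scalar (c : R) B : 0 < c -> pos_invertible dot B ->
  proj_thompson (c%:C *: id) B = ln (kappa B) / 2.
Proof.
move=> c0 posB.
have M0 := opnorm_pos_invertible_gt0 v0_neq0 posB.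
have N0 := opnorm_opinv_gt0 v0_neq0 posB.
set m := ln (opnorm B); set n := ln (opnorm (opinv B)).
have kE : ln (kappa B) / 2 = (m + n) / 2 by rewrite lnM ?posrE.
have lb : lbound
    [set thompson (c%:C *: id) (l%:C *: B) | l in [set l : R | 0 < l]] (ln (kappa B) / 2).
  move=> _ [l l0 <-]; rewrite thompson_scalar// -/m -/n kE le_max.
  set u := ln (l / c).
  (* The numbers u + m and n - u have mean (m + n) / 2, so one of them is at least that. *)
  have [h|h] := leP ((m + n) / 2) (u + m); first by rewrite (le_trans h (ler_norm _)).
  by rewrite orbC (le_trans _ (ler_norm (n - u)))//; lra.
apply/le_anti/andP; split.
  apply: ge_inf; first by exists (ln (kappa B) / 2).
  (* Solves u + m = n - u for u = ln (l / c). *)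
  pose l := c * expR ((n - m) / 2).
  have l0 : 0 < l by rewrite mulr_gt0// expR_gt0.
  exists l => //; rewrite thompson_scalar// -/m -/n kE.
  rewrite (_ : l / c = expR ((n - m) / 2)); last by rewrite /l mulrAC divff ?mul1r// gt_eqF.
  rewrite expRK.
  rewrite (_ : (n - m) / 2 + m = (m + n) / 2); last by field.
  rewrite (_ : n - (n - m) / 2 = (m + n) / 2); last by field.
  by rewrite maxxx ger0_norm// -kE divr_ge0// ln_ge0//; exact: (kappa_ge1 v0_neq0 posB).
by rewrite /proj_thompson; apply: lb_le_inf => //;
  exists (thompson (c%:C *: id) (1%:C *: B)); exists 1 => /=.
Qed.

(** The scalar c is left free because F maps the identity to an unspecified positive multiple of
    it. *)
Lemma OLC_proj_thompson (c : R) B : 0 < c -> pos_invertible dot B ->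
  OLC B = proj_thompson (c%:C *: id) B.
Proof.
move=> c0 posB; rewrite (proj_thompson_scalar c0 posB) /OLC /OMC artanh_ratio//.
exact: lt_le_trans ltr01 (kappa_ge1 v0_neq0 posB).
Qed.

(** Both quantities are increasing functions of kappa, so the comparison passes through it. *)
Lemma le_OLC_OMC A B : pos_invertible dot A -> pos_invertible dot B ->
  OLC A <= OLC B -> OMC A <= OMC B.
Proof.
move=> /(kappa_ge1 v0_neq0) A1 /(kappa_ge1 v0_neq0) B1.
have A0 := lt_le_trans ltr01 A1; have B0 := lt_le_trans ltr01 B1.
rewrite /OLC /OMC !artanh_ratio// ler_pM2r ?invr_gt0// ler_ln// => AB.
rewrite ler_pdivrMr ?addr_gt0// mulrAC ler_pdivlMr ?addr_gt0//.
lra.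
Qed.

End Nontrivial.
End Thompson.

Unset Implicit Arguments.

Theorem mainTheorem9 (R : realType) (H : completeNormedModType R[i])
    (dot : {dot H for Num.conj}) (normE : forall x : H, `|x| ^+ 2 = dot x x)
    (F : (H -> H) -> (H -> H))
    (F_pos : forall A, pos_invertible dot A -> pos_invertible dot (F A))
    (F_nonexpansive : forall A B, pos_invertible dot A -> pos_invertible dot B ->
      proj_thompson (F A) (F B) <= proj_thompson A B)
    (F_id : ray (F id) = ray id) :
  forall A, pos_invertible dot A -> OLC (F A) <= OLC A /\ OMC (F A) <= OMC A.
Proof.
move=> A posA; have [[v0 v0_neq0]|H0] := pselect (exists v0 : H, v0 != 0); last first.
  suff -> : F A = A by rewrite !lexx.
  by apply/funext => x; rewrite [LHS](_ : _ = 0) ?[RHS](_ : _ = 0)//;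
    apply/eqP/negPn/negP => nz; apply: H0; eexists; exact: nz.
have pos_id : pos_invertible dot id.
  split; [exact: bounded_id|by move=> x; rewrite -normE exprn_ge0|].
  by exists id; split=> //; exact: bounded_id.
(* The identity lies on its own ray, so equality of rays gives F(I) = c I with c > 0. *)
have [c /= c0 FidE] : ray (id : H -> H) (F id).
  by rewrite -F_id; exists 1; rewrite /= ?ltr01// scale1r.
have posFA := F_pos _ posA.
have OLC_le : OLC (F A) <= OLC A.
  rewrite (OLC_proj_thompson normE v0_neq0 c0 posFA) FidE.
  by rewrite (OLC_proj_thompson normE v0_neq0 ltr01 posA) scale1r; exact: F_nonexpansive.
by split=> //; exact: (le_OLC_OMC v0_neq0 posFA posA).
Qed.
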